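(* There is a (nonempty) family of complete immersed rotational linear Weingarten surfaces (RLWS) in $\mathbb{S}^3$ that does not contain isoparametric surfaces.
   Context: Rotational surfaces. Let $\gamma(s)=(x(s),y(s),z(s))$ be a curve in $\mathbb{S}^2$ parametrized by arc length, so $x^2+y^2+z^2=1$ and $\dot x^2+\dot y^2+\dot z^2=1$, with $x(s)\ge 0$. The rotational surface in $\mathbb{S}^3\subset\mathbb{R}^4$ with profile curve $\gamma$ is parametrized by $(s,t)\mapsto(x(s)\cos t,x(s)\sin t,y(s),z(s))$. Its principal curvatures are $$k_1=-\frac{\sqrt{1-x^2-\dot x^2}}{x},\qquad k_2=\frac{\ddot x+x}{\sqrt{1-x^2-\dot x^2}},$$ and $H=\frac{k_1+k_2}{2}$, $K=k_1k_2$. RLWS. A rotational linear Weingarten surface (RLWS) is a rotational surface in $\mathbb{S}^3$ satisfying $aH+bK=c$ for real constants $a,b,c$, where throughout $a>0$, $b\ne0$, $c\ge0$ and $\Delta=a^2+4bc\ne0$. Its profile function $x$ satisfies $$\frac a2x\sqrt{1-x^2-\dot x^2}+\frac b2(x^2+\dot x^2)+\frac c2x^2=\alpha$$ for a constant $\alpha$. Completeness. A solution $x$ of this equation is complete if either $x$ is defined for all $s\in\mathbb{R}$, or the pair $(x,\dot x)$ admits only $(0,\pm1)$ as limit values (in which case the profile curve meets the axis of rotation orthogonally). Completeness of the RLWS is understood through completeness of the (maximally extended) solution $x$. A surface in $\mathbb{S}^3$ is isoparametric if its principal curvatures are constant. *)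

(* Defs.v *)
(* Stdlib world: the real numbers [R] of the standard library, with Coquelicot. *)
From Stdlib Require Import Reals.
From Coquelicot Require Import Coquelicot.
Open Scope R_scope.

(* The open interval ]l, r[, possibly unbounded. *)
Definition in_itv (l r : Rbar) (s : R) : Prop := Rbar_lt l s /\ Rbar_lt s r.

(* Functions on ]l, r[ are total functions of which only the restriction to
   ]l, r[ matters; the interval being open, so do their derivatives there. *)
Definition C2_on (l r : Rbar) (f : R -> R) : Prop :=
  forall s : R, in_itv l r s ->
    ex_derive f s /\ ex_derive (Derive f) s /\ continuous (Derive (Derive f)) s.

(* A rotational surface is given by its profile curve (x, y, z) in the unit
   2-sphere, parametrized by arc length on ]dom_l, dom_r[. *)
Record rotational_surface : Type := RotationalSurface {
  dom_l : Rbar;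
  dom_r : Rbar;
  prof_x : R -> R;
  prof_y : R -> R;
  prof_z : R -> R;
  dom_nonempty : Rbar_lt dom_l dom_r;
  prof_x_C2 : C2_on dom_l dom_r prof_x;
  prof_y_C2 : C2_on dom_l dom_r prof_y;
  prof_z_C2 : C2_on dom_l dom_r prof_z;
  prof_sphere : forall s, in_itv dom_l dom_r s ->
    prof_x s ^ 2 + prof_y s ^ 2 + prof_z s ^ 2 = 1;
  prof_arclength : forall s, in_itv dom_l dom_r s ->
    Derive prof_x s ^ 2 + Derive prof_y s ^ 2 + Derive prof_z s ^ 2 = 1;
  prof_x_ge0 : forall s, in_itv dom_l dom_r s -> 0 <= prof_x s
}.

Definition param (S : rotational_surface) (p : R * R) : R * R * R * R :=
  (prof_x S (fst p) * cos (snd p), prof_x S (fst p) * sin (snd p),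
   prof_y S (fst p), prof_z S (fst p)).

Definition immersed (S : rotational_surface) : Prop :=
  forall s t : R, in_itv (dom_l S) (dom_r S) s ->
    exists d : R * R -> R * R * R * R,
      filterdiff (param S) (locally (s, t)) d /\
      (forall v : R * R, d v = zero -> v = zero).

Definition rad (x : R -> R) (s : R) : R := 1 - x s ^ 2 - Derive x s ^ 2.

Definition k1 (x : R -> R) (s : R) : R := - (sqrt (rad x s) / x s).

Definition k2 (x : R -> R) (s : R) : R :=
  (Derive (Derive x) s + x s) / sqrt (rad x s).

Definition H (x : R -> R) (s : R) : R := (k1 x s + k2 x s) / 2.

Definition K (x : R -> R) (s : R) : R := k1 x s * k2 x s.

(* The positivity conditions say that [k1] and [k2] are meaningful: division
   by 0 is a junk value. *)
Definition weingarten_on (a b c : R) (l r : Rbar) (x : R -> R) : Prop :=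
  forall s : R, in_itv l r s ->
    0 < x s /\ 0 < rad x s /\ a * H x s + b * K x s = c.

Definition admissible (a b c : R) : Prop :=
  0 < a /\ b <> 0 /\ 0 <= c /\ a ^ 2 + 4 * b * c <> 0.

Definition RLWS (a b c : R) (S : rotational_surface) : Prop :=
  admissible a b c /\ weingarten_on a b c (dom_l S) (dom_r S) (prof_x S).

(* The first-order equation alone would also admit functions that are not
   profile functions (at a zero of x' one may glue in a constant piece), hence
   the C^2 and Weingarten conditions. *)
Definition profile_solution
    (a b c alpha : R) (l r : Rbar) (x : R -> R) : Prop :=
  Rbar_lt l r /\ C2_on l r x /\ weingarten_on a b c l r x /\
  forall s : R, in_itv l r s ->
    a / 2 * x s * sqrt (rad x s) + b / 2 * (x s ^ 2 + Derive x s ^ 2)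
      + c / 2 * x s ^ 2 = alpha.

Definition maximal_solution
    (a b c alpha : R) (l r : Rbar) (x : R -> R) : Prop :=
  profile_solution a b c alpha l r x /\
  forall (l' r' : Rbar) (x' : R -> R),
    profile_solution a b c alpha l' r' x' ->
    Rbar_le l' l -> Rbar_le r r' ->
    (forall s, in_itv l r s -> x' s = x s) ->
    l' = l /\ r' = r.

(* (p, q) is a limit value of (x, x') at an end of ]l, r[. *)
Definition limit_value (l r : Rbar) (x : R -> R) (p q : R) : Prop :=
  exists (e : Rbar) (u : nat -> R),
    (e = l \/ e = r) /\
    (forall n : nat, in_itv l r (u n)) /\
    is_lim_seq u e /\
    is_lim_seq (fun n => x (u n)) p /\
    is_lim_seq (fun n => Derive x (u n)) q.

Definition complete_solution (l r : Rbar) (x : R -> R) : Prop :=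
  (l = m_infty /\ r = p_infty) \/
  (forall p q : R, limit_value l r x p q -> p = 0 /\ (q = 1 \/ q = -1)).

Definition complete_RLWS (a b c : R) (S : rotational_surface) : Prop :=
  RLWS a b c S /\
  exists alpha : R,
    maximal_solution a b c alpha (dom_l S) (dom_r S) (prof_x S) /\
    complete_solution (dom_l S) (dom_r S) (prof_x S).

Definition isoparametric (S : rotational_surface) : Prop :=
  exists c1 c2 : R, forall s : R, in_itv (dom_l S) (dom_r S) s ->
    k1 (prof_x S) s = c1 /\ k2 (prof_x S) s = c2.

(* Main.v *)
(** Put [u = sqrt (1 - x^2 - x'^2)].  Then [k1 = - u / x] and, since
    [u' = - x' (x'' + x) / u], [k2 = - du/dx]; hence [aH + bK = c] says that
    [(x, u)] stays on a conic [a x u - b u^2 + c x^2 = const], and a solution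
    oscillates along the arc of that conic inside the unit disc, turning back
    where the arc meets the unit circle.  For [a = 4], [b = -3], [c = 0] we take
    the conic [8 x u + 6 u^2 = 7], which meets the unit circle at [u^2 = 1/2]
    and [u^2 = 49/50].  Writing [u^2 = (37 + 12 sin phi) / 50] turns
    [x'^2 = 1 - x^2 - u^2] into [phi' = 20 u^2 / (7 + 6 u^2)], which has a
    global solution, so [x] is defined on the whole line.  At the two turning
    points [k1] is [-1] and [-7], so it is not constant. *)
Require Import Defs.
From Stdlib Require Import Reals Lra.
From Coquelicot Require Import Coquelicot.
Open Scope R_scope.

(** * Global solutions of autonomous equations *)

Lemma primitive_exists (h : R -> R) :
  (forall s, continuous h s) -> exists P : R -> R, forall s, is_derive P s (h s).
Proof.
intros ch; exists (fun s => RInt h 0 s); intros s.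
apply (is_derive_RInt h _ 0); [|apply ch].
apply filter_forall; intros t.
apply (RInt_correct (V := R_CompleteNormedModule) h 0 t).
apply (ex_RInt_continuous (V := R_CompleteNormedModule)).
intros z _; apply ch.
Qed.

Lemma derive_mean_value (f df : R -> R) (a b : R) :
  (forall s, is_derive f s (df s)) ->
  exists c, Rmin a b <= c <= Rmax a b /\ f b - f a = df c * (b - a).
Proof.
intros Df; destruct (MVT_gen f a b df) as [c Hc].
- intros s _; apply Df.
- intros s _; apply continuity_pt_filterlim, (@ex_derive_continuous R_AbsRing R_NormedModule).
  exists (df s); apply Df.
- exists c; exact Hc.
Qed.

(* The flow is the inverse of a primitive of [h]. *)
Lemma autonomous_ode_global (h : R -> R) (m : R) :
  0 < m -> (forall t, m <= h t) -> (forall t, continuous h t) ->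
  exists phi : R -> R,
    (forall s, is_derive phi s (/ h (phi s))) /\ (forall t, exists s, phi s = t).
Proof.
intros m0 hm ch.
destruct (primitive_exists h ch) as [T DT].
assert (cT : Ranalysis1.continuity T).
{ intros t; apply continuity_pt_filterlim, (@ex_derive_continuous R_AbsRing R_NormedModule).
  exists (h t); apply DT. }
assert (grow : forall a b, a <= b -> m * (b - a) <= T b - T a).
{ intros a b ab; destruct (derive_mean_value T h a b DT) as [c [_ ->]].
  apply Rmult_le_compat_r; [lra|apply hm]. }
assert (inv : forall s, {t : R | T t = s}).
{ intros s.
  (* [T] grows at rate at least [m], so it takes the value [s] within distance [r] of 0. *)
  set (r := (Rabs (s - T 0)) / m).
  assert (r0 : 0 <= r).
  { apply Rmult_le_pos; [apply Rabs_pos|]. apply Rlt_le, Rinv_0_lt_compat, m0. }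
  assert (mr : m * r = Rabs (s - T 0)) by (unfold r; field; lra).
  assert (lo : T (- r) <= s).
  { generalize (grow (- r) 0 ltac:(lra)) (Rle_abs (- (s - T 0))).
    rewrite Rabs_Ropp; lra. }
  assert (hi : s <= T r).
  { generalize (grow 0 r ltac:(lra)) (Rle_abs (s - T 0)); lra. }
  destruct (IVT_gen T (- r) r s cT) as [t [_ Tt]].
  - split; [apply Rle_trans with (1 := Rmin_l _ _), lo|].
    apply Rle_trans with (2 := Rmax_r _ _), hi.
  - exists t; exact Tt. }
pose (phi := fun s => proj1_sig (inv s)).
assert (Tphi : forall s, T (phi s) = s) by (intros s; exact (proj2_sig (inv s))).
exists phi; split.
- intros s.
  assert (hpos : forall t, 0 < h t) by (intros t; generalize (hm t); lra).
  assert (ci : continuous (fun t => / h t) (phi s)).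
  { apply (continuous_comp h Rinv); [apply ch|].
    apply continuous_Rinv; generalize (hpos (phi s)); lra. }
  apply is_derive_Reals; intros eps eps0.
  destruct (proj1 (filterlim_locally _ _) ci (mkposreal eps eps0)) as [d Hd].
  (* By the mean value theorem the difference quotient of [phi] is exactly [/ h c] for some [c]
     between [phi s] and [phi (s + k)]. These two points are at most [Rabs k / m] apart, so
     [Rabs k < m * d] brings [c] within [d] of [phi s]. *)
  assert (md0 : 0 < m * d) by (apply Rmult_lt_0_compat; [lra|apply cond_pos]).
  exists (mkposreal _ md0); simpl; intros k k0 kd.
  destruct (derive_mean_value T h (phi s) (phi (s + k)) DT) as [c [cb Hc]].
  rewrite !Tphi in Hc.
  replace (s + k - s) with k in Hc by ring.
  assert (Hq : (phi (s + k) - phi s) / k = / h c).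
  { assert (phi (s + k) - phi s = k * / h c) as ->.
    { rewrite Hc at 2; field; generalize (hpos c); lra. }
    field; split; [generalize (hpos c); lra|exact k0]. }
  assert (close : Rabs (c - phi s) < d).
  { apply Rle_lt_trans with (Rabs (phi (s + k) - phi s)).
    - revert cb; unfold Rmin, Rmax; destruct (Rle_dec (phi s) (phi (s + k)));
        intros cb; unfold Rabs; destruct (Rcase_abs (c - phi s)),
        (Rcase_abs (phi (s + k) - phi s)); lra.
    - apply Rmult_lt_reg_l with m; [lra|].
      apply Rle_lt_trans with (2 := kd).
      rewrite Hc at 2; rewrite Rabs_mult, (Rabs_pos_eq (h c)) by (generalize (hpos c); lra).
      apply Rmult_le_compat_r; [apply Rabs_pos|apply hm]. }
  rewrite Hq; exact (Hd c close).
(* [phi (T t)] and [t] have the same image under [T], and [grow] makes [T] injective. *)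
- intros t; exists (T t).
  destruct (Rle_or_lt (phi (T t)) t) as [le|lt].
  + generalize (grow _ _ le); rewrite Tphi; nra.
  + generalize (grow _ _ (Rlt_le _ _ lt)); rewrite Tphi; nra.
Qed.

(** * Closure properties of C^1 functions on the line *)

Definition C1 (f : R -> R) : Prop :=
  exists df : R -> R,
    (forall s, is_derive f s (df s)) /\ (forall s, continuous df s).

Definition C2 (f : R -> R) : Prop :=
  exists df : R -> R, (forall s, is_derive f s (df s)) /\ C1 df.

Lemma C1_continuous (f : R -> R) (s : R) : C1 f -> continuous f s.
Proof.
intros [df [Df _]]; apply (@ex_derive_continuous R_AbsRing R_NormedModule).
exists (df s); apply Df.
Qed.

Lemma C2_C1 (f : R -> R) : C2 f -> C1 f.
Proof.
intros [df [Df Cdf]]; exists df; split; [exact Df|].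
intros s; apply C1_continuous, Cdf.
Qed.

Lemma C1_ext (f g : R -> R) : (forall s, f s = g s) -> C1 f -> C1 g.
Proof.
intros fg [df [Df cdf]]; exists df; split; [|exact cdf].
intros s; apply (is_derive_ext f); [exact fg|apply Df].
Qed.

Lemma C1_const (k : R) : C1 (fun _ => k).
Proof.
exists (fun _ => 0); split; intros s; [apply @is_derive_const|apply continuous_const].
Qed.

Lemma C1_plus (f g : R -> R) : C1 f -> C1 g -> C1 (fun s => f s + g s).
Proof.
intros [df [Df cdf]] [dg [Dg cdg]]; exists (fun s => df s + dg s); split; intros s.
- apply (is_derive_plus f g); auto.
- apply (continuous_plus df dg); auto.
Qed.

Lemma C1_mult (f g : R -> R) : C1 f -> C1 g -> C1 (fun s => f s * g s).
Proof.
intros Cf Cg; destruct (Cf) as [df [Df cdf]], (Cg) as [dg [Dg cdg]].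
exists (fun s => df s * g s + f s * dg s); split; intros s.
- apply (is_derive_mult f g); auto; intros; apply Rmult_comm.
- apply (continuous_plus (fun s => df s * g s) (fun s => f s * dg s)).
  + apply (continuous_mult df g); [auto|apply C1_continuous, Cg].
  + apply (continuous_mult f dg); [apply C1_continuous, Cf|auto].
Qed.

Lemma C1_inv (f : R -> R) : (forall s, f s <> 0) -> C1 f -> C1 (fun s => / f s).
Proof.
intros f0 Cf; destruct (Cf) as [df [Df cdf]].
assert (ci : forall s, continuous (fun s => / f s) s).
{ intros s; apply (continuous_comp f Rinv); [apply C1_continuous, Cf|].
  apply continuous_Rinv, f0. }
exists (fun s => - df s * (/ f s * / f s)); split; intros s.
- replace (- df s * (/ f s * / f s)) with (- df s / f s ^ 2) by (field; apply f0).
  apply is_derive_inv; auto.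
- apply (continuous_mult (fun s => - df s) (fun s => / f s * / f s)).
  + apply (continuous_opp df), cdf.
  + apply (continuous_mult (fun s => / f s) (fun s => / f s)); apply ci.
Qed.

Lemma is_derive_sqrt_pos (f : R -> R) (s l : R) :
  0 < f s -> is_derive f s l ->
  is_derive (fun t => sqrt (f t)) s (l * / (2 * sqrt (f s))).
Proof.
intros f0 Df; apply (is_derive_comp sqrt f); [|exact Df].
apply is_derive_Reals, derivable_pt_lim_sqrt, f0.
Qed.

Lemma C1_sqrt (f : R -> R) : (forall s, 0 < f s) -> C1 f -> C1 (fun s => sqrt (f s)).
Proof.
intros f0 Cf; destruct (Cf) as [df [Df cdf]].
exists (fun s => df s * / (2 * sqrt (f s))); split; intros s.
- apply is_derive_sqrt_pos; auto.
- apply (continuous_mult df (fun s => / (2 * sqrt (f s)))); [auto|].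
  apply (continuous_comp (fun s => 2 * sqrt (f s)) Rinv).
  + apply (continuous_mult (fun _ => 2) (fun s => sqrt (f s))); [apply continuous_const|].
    apply (continuous_comp f sqrt); [apply C1_continuous, Cf|apply continuous_sqrt].
  + apply continuous_Rinv; generalize (sqrt_lt_R0 _ (f0 s)); lra.
Qed.

Lemma C1_cos (f : R -> R) : C1 f -> C1 (fun s => cos (f s)).
Proof.
intros Cf; destruct (Cf) as [df [Df cdf]].
exists (fun s => df s * - sin (f s)); split; intros s.
- apply (is_derive_comp cos f); [apply is_derive_cos|apply Df].
- apply (continuous_mult df (fun s => - sin (f s))); [auto|].
  apply (continuous_opp (fun s => sin (f s))).
  apply (continuous_comp f sin); [apply C1_continuous, Cf|apply continuous_sin].
Qed.

Lemma C1_sin (f : R -> R) : C1 f -> C1 (fun s => sin (f s)).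
Proof.
intros Cf; destruct (Cf) as [df [Df cdf]].
exists (fun s => df s * cos (f s)); split; intros s.
- apply (is_derive_comp sin f); [apply is_derive_sin|apply Df].
- apply (continuous_mult df (fun s => cos (f s))); [auto|].
  apply (continuous_comp f cos); [apply C1_continuous, Cf|apply continuous_cos].
Qed.

(** Inverses and square roots are left out: they need a sign condition and are treated by hand. *)
Ltac solve_C1 :=
  match goal with
  | |- C1 (fun _ => _ + _) => apply C1_plus; solve_C1
  | |- C1 (fun _ => _ * _) => apply C1_mult; solve_C1
  | |- C1 (fun s => cos _) => apply C1_cos; solve_C1
  | |- C1 (fun s => sin _) => apply C1_sin; solve_C1
  | |- C1 (fun _ => ?k) => apply C1_const
  | _ => try assumption
  end.

(** * From the profile function to the profile curve *)

Lemma C2_on_C2 (l r : Rbar) (f : R -> R) : C2 f -> C2_on l r f.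
Proof.
intros [df [Df [ddf [Ddf cddf]]]] s _.
assert (E1 : forall t, Derive f t = df t) by (intros t; apply is_derive_unique, Df).
assert (E2 : forall t, Derive (Derive f) t = ddf t).
{ intros t; rewrite (Derive_ext _ df _ E1); apply is_derive_unique, Ddf. }
split; [exists (df s); apply Df|split].
- exists (ddf s); apply (is_derive_ext df); [intros t; symmetry; apply E1|apply Ddf].
- apply (continuous_ext ddf); [intros t; symmetry; apply E2|apply cddf].
Qed.

(* In polar form [y + i z = sqrt (1 - x^2) e^(i psi)], arc length means
   [psi' = sqrt (1 - x^2 - x'^2) / (1 - x^2)]. *)
Lemma profile_exists (x : R -> R) :
  C2 x -> (forall s, 0 < rad x s) ->
  exists y z : R -> R, C2 y /\ C2 z /\
    (forall s, x s ^ 2 + y s ^ 2 + z s ^ 2 = 1) /\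
    (forall s, Derive x s ^ 2 + Derive y s ^ 2 + Derive z s ^ 2 = 1).
Proof.
intros C2x rpos; destruct (C2x) as [dx [Dx C1dx]].
assert (C1x := C2_C1 _ C2x).
assert (Ex : forall s, Derive x s = dx s) by (intros s; apply is_derive_unique, Dx).
(* Differences are written with [+] and [*] only, the shapes that [solve_C1] recognises. *)
assert (rE : forall s, rad x s = 1 + (-1) * (x s * x s) + (-1) * (dx s * dx s)).
{ intros s; unfold rad; rewrite Ex; ring. }
assert (C1rad : C1 (rad x)).
{ apply (C1_ext (fun s => 1 + (-1) * (x s * x s) + (-1) * (dx s * dx s))).
  - intros s; symmetry; apply rE.
  - solve_C1. }
(* [p = sqrt q] is the modulus of the polar form and [w] its angular speed; [q = rad x + x'^2] is
   positive. *)
pose (q := fun s => 1 + (-1) * (x s * x s)).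
assert (qpos : forall s, 0 < q s).
{ intros s; generalize (rpos s); rewrite rE; unfold q; nra. }
assert (Dq : forall s, is_derive q s (-2 * (x s * dx s))).
{ intros s; unfold q; auto_derive; [repeat split; exists (dx s); apply Dx|].
  change (fun x0 => x x0) with x; rewrite Ex; ring. }
assert (C1q : C1 q).
{ unfold q; solve_C1. }
pose (p := fun s => sqrt (q s)).
pose (dp := fun s => -2 * (x s * dx s) * / (2 * p s)).
assert (ppos : forall s, 0 < p s) by (intros s; apply sqrt_lt_R0, qpos).
assert (Dp : forall s, is_derive p s (dp s)).
{ intros s; apply (is_derive_sqrt_pos q); [apply qpos|apply Dq]. }
assert (C1p : C1 p) by (apply (C1_sqrt q qpos C1q)).
assert (C1dp : C1 dp).
{ unfold dp; apply C1_mult.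
  - solve_C1.
  - apply C1_inv; [intros s; generalize (ppos s); lra|].
    apply C1_mult; [apply C1_const|exact C1p]. }
pose (w := fun s => sqrt (rad x s) * / q s).
assert (C1w : C1 w).
{ apply C1_mult; [apply C1_sqrt; assumption|].
  apply C1_inv; [intros s; generalize (qpos s); lra|exact C1q]. }
destruct (primitive_exists w) as [psi Dpsi].
{ intros s; apply C1_continuous, C1w. }
assert (C1psi : C1 psi).
{ apply C2_C1; exists w; split; [exact Dpsi|exact C1w]. }
assert (psq : forall s, p s ^ 2 = q s).
{ intros s; apply pow2_sqrt, Rlt_le, qpos. }
pose (dy := fun s => dp s * cos (psi s) + (-1) * (p s * (w s * sin (psi s)))).
pose (dz := fun s => dp s * sin (psi s) + p s * (w s * cos (psi s))).
assert (Epsi : forall s, Derive psi s = w s) by (intros s; apply is_derive_unique, Dpsi).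
assert (Ep : forall s, Derive p s = dp s) by (intros s; apply is_derive_unique, Dp).
assert (Dy : forall s, is_derive (fun s : R => p s * cos (psi s)) s (dy s)).
{ intros s; auto_derive.
  - repeat split; [exists (dp s); apply Dp|exists (w s); apply Dpsi].
  - change (fun x => p x) with p; change (fun x => psi x) with psi.
    rewrite Ep, Epsi; unfold dy; ring. }
assert (Dz : forall s, is_derive (fun s : R => p s * sin (psi s)) s (dz s)).
{ intros s; auto_derive.
  - repeat split; [exists (dp s); apply Dp|exists (w s); apply Dpsi].
  - change (fun x => p x) with p; change (fun x => psi x) with psi.
    rewrite Ep, Epsi; unfold dz; ring. }
exists (fun s => p s * cos (psi s)), (fun s => p s * sin (psi s)).
repeat split.
- exists dy; split; [exact Dy|unfold dy; solve_C1].
- exists dz; split; [exact Dz|unfold dz; solve_C1].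
- intros s; generalize (sin2_cos2 (psi s)) (psq s); unfold q, Rsqr; intros E1 E2.
  replace (x s ^ 2 + (p s * cos (psi s)) ^ 2 + (p s * sin (psi s)) ^ 2)
    with (x s ^ 2 + p s ^ 2 * (sin (psi s) * sin (psi s) + cos (psi s) * cos (psi s)))
    by ring.
  rewrite E1, E2; ring.
- intros s; rewrite Ex, (is_derive_unique _ _ _ (Dy s)), (is_derive_unique _ _ _ (Dz s)).
  generalize (sin2_cos2 (psi s)); unfold Rsqr; intros E1.
  (* The cross terms cancel. Since [p'^2 = (x x')^2 / q] and [p^2 w^2 = rad x / q], these two add up
     to [1 - x'^2]. *)
  replace (dx s ^ 2 + dy s ^ 2 + dz s ^ 2)
    with (dx s ^ 2 + (dp s ^ 2 + p s ^ 2 * w s ^ 2)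
      * (sin (psi s) * sin (psi s) + cos (psi s) * cos (psi s)))
    by (unfold dy, dz; ring).
  rewrite E1, psq.
  replace (dp s ^ 2) with ((x s * dx s) ^ 2 / p s ^ 2)
    by (unfold dp; field; generalize (ppos s); lra).
  replace (w s ^ 2) with (sqrt (rad x s) ^ 2 / q s ^ 2)
    by (unfold w; field; generalize (qpos s); lra).
  rewrite psq, pow2_sqrt, rE by apply Rlt_le, rpos.
  generalize (qpos s); unfold q; intros qs; field; lra.
Qed.

(** * Immersion away from the axis *)

Lemma filterdiff_prod {T U V : NormedModule R_AbsRing} (f : T -> U) (g : T -> V)
    (p : T) (df : T -> U) (dg : T -> V) :
  filterdiff f (locally p) df -> filterdiff g (locally p) dg ->
  filterdiff (fun t => (f t, g t) : prod_NormedModule R_AbsRing U V) (locally p)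
    (fun t => (df t, dg t)).
Proof.
intros Df Dg.
apply (filterdiff_comp_2 f g (fun u v => (u, v) : prod_NormedModule R_AbsRing U V)
  df dg (fun u v => (u, v)) Df Dg).
(* Pairing is the identity of the product space, hence its own differential. *)
apply (filterdiff_ext_lin _ (fun t => t)); [|intros [u v]; reflexivity].
apply (filterdiff_ext (fun t => t)); [intros [u v]; reflexivity|].
apply filterdiff_id.
Qed.

Lemma filterdiff_of_fst (f : R -> R) (s t l : R) :
  is_derive f s l ->
  filterdiff (fun p : R * R => f (fst p)) (locally (s, t)) (fun v => fst v * l).
Proof.
intros Df; apply (filterdiff_comp' (fun p : R * R => fst p) f (s, t) fst (fun v => v * l)).
- apply filterdiff_linear, is_linear_fst.
- exact Df.
Qed.

Lemma filterdiff_of_snd (f : R -> R) (s t l : R) :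
  is_derive f t l ->
  filterdiff (fun p : R * R => f (snd p)) (locally (s, t)) (fun v => snd v * l).
Proof.
intros Df; apply (filterdiff_comp' (fun p : R * R => snd p) f (s, t) snd (fun v => v * l)).
- apply filterdiff_linear, is_linear_snd.
- exact Df.
Qed.

(** Positivity of [rad] gives [y'^2 + z'^2 = 1 - x'^2 > 0], so the last two components of the
    differential detect [v1]; the rotating plane then detects [v2] because [x > 0]. *)
Lemma immersed_off_axis (S : rotational_surface) :
  (forall s, in_itv (dom_l S) (dom_r S) s -> 0 < prof_x S s /\ 0 < rad (prof_x S) s) ->
  immersed S.
Proof.
intros Hpos s t Is; destruct (Hpos s Is) as [xpos rpos].
pose (x' := Derive (prof_x S) s).
pose (y' := Derive (prof_y S) s).
pose (z' := Derive (prof_z S) s).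
assert (Dx := Derive_correct _ _ (proj1 (prof_x_C2 S s Is))).
assert (Dy := Derive_correct _ _ (proj1 (prof_y_C2 S s Is))).
assert (Dz := Derive_correct _ _ (proj1 (prof_z_C2 S s Is))).
exists (fun v => (fst v * x' * cos t + prof_x S s * (snd v * - sin t),
                  fst v * x' * sin t + prof_x S s * (snd v * cos t),
                  fst v * y', fst v * z')).
split.
- unfold param.
  apply (filterdiff_prod (fun p : R * R => (prof_x S (fst p) * cos (snd p),
    prof_x S (fst p) * sin (snd p), prof_y S (fst p)))
    (fun p : R * R => prof_z S (fst p))); [|apply filterdiff_of_fst, Dz].
  apply (filterdiff_prod (fun p : R * R => (prof_x S (fst p) * cos (snd p),
    prof_x S (fst p) * sin (snd p))) (fun p : R * R => prof_y S (fst p)));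
    [|apply filterdiff_of_fst, Dy].
  apply (filterdiff_prod (fun p : R * R => prof_x S (fst p) * cos (snd p))
    (fun p : R * R => prof_x S (fst p) * sin (snd p))).
  + apply (filterdiff_mult_fct (fun p : R * R => prof_x S (fst p))
      (fun p : R * R => cos (snd p)) (s, t)); [intros; apply Rmult_comm| |].
    * apply filterdiff_of_fst, Dx.
    * apply filterdiff_of_snd, is_derive_cos.
  + apply (filterdiff_mult_fct (fun p : R * R => prof_x S (fst p))
      (fun p : R * R => sin (snd p)) (s, t)); [intros; apply Rmult_comm| |].
    * apply filterdiff_of_fst, Dx.
    * apply filterdiff_of_snd, is_derive_sin.
- intros [v1 v2] E; change (zero : R * R) with (0, 0).
  change (zero : R * R * R * R) with (0, 0, 0, 0) in E; simpl in E.
  injection E as E1 E2 E3 E4.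
  generalize (prof_arclength S s Is) (sin2_cos2 t); fold x' y' z'; unfold Rsqr.
  unfold rad in rpos; fold x' in rpos.
  intros Earc Etrig.
  assert (v10 : v1 = 0).
  { assert (P : v1 ^ 2 * (y' ^ 2 + z' ^ 2) = 0).
    { replace (v1 ^ 2 * (y' ^ 2 + z' ^ 2)) with ((v1 * y') ^ 2 + (v1 * z') ^ 2) by ring.
      rewrite E3, E4; ring. }
    apply Rmult_integral in P; destruct P as [P|P]; [nra|].
    exfalso; nra. }
  (* Rotating the first two components back by the angle [t] isolates [x v2]. *)
  assert (v20 : prof_x S s * v2 = 0).
  { replace (prof_x S s * v2)
      with ((v1 * x' * sin t + prof_x S s * (v2 * cos t)) * cos t
        - (v1 * x' * cos t + prof_x S s * (v2 * - sin t)) * sin t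
        + prof_x S s * v2 * (1 - (sin t * sin t + cos t * cos t))) by ring.
    rewrite E1, E2, Etrig; ring. }
  apply Rmult_integral in v20; destruct v20 as [v20|v20]; [lra|].
  rewrite v10, v20; reflexivity.
Qed.

(** * The oscillating solution *)

Lemma in_real_line (s : R) : in_itv m_infty p_infty s.
Proof. split; exact I. Qed.

(** With [u = sqrt (rad x)], differentiating the conic gives [- du/dx = 8 u^2 / (7 + 6 u^2)], which
    is [k2]; the second-order equation is [x'' + x = u k2]. The last two clauses provide the turning
    points. *)
Lemma oscillating_profile :
  exists x : R -> R, C2 x /\
    (forall s, 0 < x s) /\ (forall s, 0 < rad x s) /\
    (forall s, 8 * x s * sqrt (rad x s) + 6 * rad x s = 7) /\
    (forall s, Derive (Derive x) s + x s = 8 * sqrt (rad x s) ^ 3 / (7 + 6 * rad x s)) /\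
    (exists s, rad x s = 1 / 2) /\ (exists s, rad x s = 49 / 50).
Proof.
(* On the conic [x = (7 - 6 u^2) / (8 u)], so [64 u^2 (1 - x^2 - u^2) = -100 u^4 + 148 u^2 - 49].
   Its roots in [u^2] are 1/2 and 49/50, with midpoint 37/50 and half-distance 12/50. *)
pose (v := fun t => (37 + 12 * sin t) / 50).
assert (vb : forall t, 1 / 2 <= v t <= 49 / 50).
{ intros t; unfold v; generalize (SIN_bound t); lra. }
pose (h := fun t => (7 + 6 * v t) / (20 * v t)).
(* [h] is [ds/dphi], and [h = 3/10 + 7 / (20 v)] with [v > 0]. *)
destruct (autonomous_ode_global h (3 / 10)) as [phi [Dphi phi_onto]].
{ lra. }
{ intros t; unfold h; generalize (vb t); intros vt.
  apply Rmult_le_reg_r with (20 * v t); [lra|].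
  replace ((7 + 6 * v t) / (20 * v t) * (20 * v t)) with (7 + 6 * v t) by (field; lra).
  lra. }
{ intros t; apply (@ex_derive_continuous R_AbsRing R_NormedModule).
  unfold h, v; auto_derive; generalize (vb t); unfold v; lra. }
pose (u := fun s => sqrt (v (phi s))).
assert (upos : forall s, 0 < u s).
{ intros s; apply sqrt_lt_R0; generalize (vb (phi s)); lra. }
assert (usq : forall s, u s ^ 2 = v (phi s)).
{ intros s; apply pow2_sqrt; generalize (vb (phi s)); lra. }
pose (dphi := fun s => 20 * u s ^ 2 / (7 + 6 * u s ^ 2)).
assert (Dphi' : forall s, is_derive phi s (dphi s)).
{ intros s; replace (dphi s) with (/ h (phi s)); [apply Dphi|].
  unfold dphi, h; rewrite usq; generalize (vb (phi s)); intros; field; lra. }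
assert (Du : forall s, is_derive u s (3 / 25 * cos (phi s) * dphi s / u s)).
{ intros s.
  replace (3 / 25 * cos (phi s) * dphi s / u s)
    with (6 / 25 * cos (phi s) * dphi s * / (2 * u s))
    by (field; generalize (upos s); lra).
  apply (is_derive_sqrt_pos (fun s => v (phi s))); [generalize (vb (phi s)); lra|].
  unfold v; auto_derive; [exists (dphi s); apply Dphi'|].
  change (fun x => phi x) with phi.
  rewrite (is_derive_unique _ _ _ (Dphi' s)); field. }
pose (x := fun s => (7 - 6 * u s ^ 2) / (8 * u s)).
(* In terms of [phi] the quartic above is [(144/25) cos^2 phi], so [x'^2 = (3/10 cos phi / u)^2].
   This root is smooth and changes sign at the turning points; the chain rule then forces [dphi]. *)
pose (dx := fun s => - (3 / 10 * cos (phi s) / u s)).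
pose (ddx := fun s => 8 * u s ^ 3 / (7 + 6 * u s ^ 2) - x s).
assert (u0 : forall s, u s <> 0) by (intros s; generalize (upos s); lra).
assert (d0 : forall s, 7 + 6 * u s ^ 2 <> 0).
{ intros s; generalize (pow2_ge_0 (u s)); lra. }
assert (trig : forall s, cos (phi s) ^ 2 = 1 - ((50 * u s ^ 2 - 37) / 12) ^ 2).
{ intros s; rewrite usq; generalize (sin2_cos2 (phi s)).
  unfold v, Rsqr; intros; nra. }
assert (Dx : forall s, is_derive x s (dx s)).
{ intros s; unfold x; auto_derive.
  - repeat split; [exists (3 / 25 * cos (phi s) * dphi s / u s); apply Du
                  |exists (3 / 25 * cos (phi s) * dphi s / u s); apply Du|].
    generalize (u0 s); lra.
  - change (fun x => u x) with u; rewrite (is_derive_unique _ _ _ (Du s)).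
    unfold dx, dphi; field; split; [apply u0|apply d0]. }
assert (Ddx : forall s, is_derive dx s (ddx s)).
{ intros s; unfold dx; auto_derive.
  - repeat split; [exists (dphi s); apply Dphi'
                  |exists (3 / 25 * cos (phi s) * dphi s / u s); apply Du|apply u0].
  - change (fun x => u x) with u; change (fun x => phi x) with phi.
    rewrite (is_derive_unique _ _ _ (Du s)), (is_derive_unique _ _ _ (Dphi' s)).
    assert (Es : sin (phi s) = (50 * u s ^ 2 - 37) / 12).
    { rewrite usq; unfold v; field. }
    (* Only [sin phi] and [cos^2 phi] remain, both polynomials in [u^2], which leaves a rational
       identity in [u]. *)
    transitivity (dphi s *
      (3 / 10 * sin (phi s) / u s + 9 / 250 * cos (phi s) ^ 2 / u s ^ 3)).
    + field; apply u0.
    + rewrite Es, trig; unfold ddx, x, dphi; field; split; [apply u0|apply d0]. }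
assert (C1u : C1 u).
{ apply (C1_sqrt (fun s => v (phi s))); [intros s; generalize (vb (phi s)); lra|].
  unfold v, Rdiv.
  solve_C1.
  exists dphi; split; [exact Dphi'|]; intros s.
  apply (@ex_derive_continuous R_AbsRing R_NormedModule).
  unfold dphi; auto_derive; split; [|split; [|split]].
  - exists (3 / 25 * cos (phi s) * dphi s / u s); apply Du.
  - exists (3 / 25 * cos (phi s) * dphi s / u s); apply Du.
  - apply d0.
  - exact I. }
assert (Ex : forall s, Derive x s = dx s) by (intros s; apply is_derive_unique, Dx).
assert (Eddx : forall s, Derive (Derive x) s = ddx s).
{ intros s; rewrite (Derive_ext _ dx _ Ex); apply is_derive_unique, Ddx. }
assert (Er : forall s, rad x s = u s ^ 2).
{ intros s; unfold rad; rewrite Ex.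
  replace (dx s ^ 2) with (9 / 100 * cos (phi s) ^ 2 / u s ^ 2)
    by (unfold dx; field; apply u0).
  rewrite trig; unfold x; field; apply u0. }
assert (Esr : forall s, sqrt (rad x s) = u s).
{ intros s; rewrite Er; apply sqrt_pow2, Rlt_le, upos. }
exists x; repeat split.
- exists dx; split; [exact Dx|]; exists ddx; split; [exact Ddx|]; intros s.
  apply (@ex_derive_continuous R_AbsRing R_NormedModule).
  assert (exu : ex_derive u s).
  { exists (3 / 25 * cos (phi s) * dphi s / u s); apply Du. }
  unfold ddx, x; auto_derive; repeat split; try exact exu; try apply d0.
  generalize (u0 s); lra.
- intros s; apply Rdiv_lt_0_compat; [rewrite usq; generalize (vb (phi s)); lra|].
  generalize (upos s); lra.
- intros s; rewrite Er; apply pow_lt, upos.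
- intros s; rewrite Esr, Er; unfold x; field; apply u0.
- intros s; rewrite Eddx, Esr, Er; unfold ddx; ring.
(* Surjectivity of [phi] ensures that the phases [- PI / 2] and [PI / 2], the two turning points,
   are reached. *)
- destruct (phi_onto (- (PI / 2))) as [s Hs]; exists s.
  rewrite Er, usq, Hs; unfold v; rewrite sin_neg, sin_PI2; field.
- destruct (phi_onto (PI / 2)) as [s Hs]; exists s.
  rewrite Er, usq, Hs; unfold v; rewrite sin_PI2; field.
Qed.

(** * Maximality and the family *)

Lemma maximal_solution_real_line (a b c alpha : R) (x : R -> R) :
  profile_solution a b c alpha m_infty p_infty x ->
  maximal_solution a b c alpha m_infty p_infty x.
Proof.
intros Hx; split; [exact Hx|]; intros l' r' x' _ Hl Hr _.
destruct l', r'; simpl in Hl, Hr; try contradiction; split; reflexivity.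
Qed.

Theorem theorem2 :
  exists F : rotational_surface -> Prop,
    (exists S : rotational_surface, F S) /\
    (forall S : rotational_surface, F S ->
       (exists a b c : R, complete_RLWS a b c S) /\
       immersed S /\
       ~ isoparametric S).
Proof.
(* All complete non-isoparametric RLWS are taken; each is immersed since the Weingarten condition
   includes [x > 0] and [rad x > 0]. The content is that the family is nonempty. *)
exists (fun S => (exists a b c : R, complete_RLWS a b c S) /\ ~ isoparametric S).
split.
- destruct oscillating_profile as [x [C2x [xpos [rpos [conic [x'' [[s1 r1] [s2 r2]]]]]]]].
  destruct (profile_exists x C2x rpos) as [y [z [C2y [C2z [sph arc]]]]].
  exists (RotationalSurface m_infty p_infty x y z I
    (C2_on_C2 _ _ x C2x) (C2_on_C2 _ _ y C2y) (C2_on_C2 _ _ z C2z)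
    (fun s _ => sph s) (fun s _ => arc s) (fun s _ => Rlt_le _ _ (xpos s))).
  assert (W : weingarten_on 4 (-3) 0 m_infty p_infty x).
  { intros s _; split; [apply xpos|split; [apply rpos|]].
    unfold H, K, k1, k2; rewrite x''.
    assert (upos := sqrt_lt_R0 _ (rpos s)).
    assert (usq := pow2_sqrt _ (Rlt_le _ _ (rpos s))).
    generalize (conic s) (xpos s); rewrite <- usq; revert upos.
    set (u := sqrt (rad x s)); intros upos.
    rewrite sqrt_pow2 by lra; intros E xs.
    (* The conic turns [k2] into [2 u / (2 x + 3 u)], and [2 (k1 + k2) - 3 k1 k2 = 0] becomes an
       identity in [x] and [u]. *)
    assert (7 + 6 * u ^ 2 = 8 * x s * u + 12 * u ^ 2) as -> by lra.
    field; nra. }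
  split.
  + exists 4, (-3), 0; split.
    * split; [|exact W]; unfold admissible; lra.
    (* As [x^2 + x'^2 = 1 - u^2], the left side is [(8 x u + 6 u^2) / 4 - 3/2 = 7/4 - 3/2]. *)
    * exists (1 / 4); split; [|left; split; reflexivity].
      apply maximal_solution_real_line; split; [exact I|].
      split; [apply C2_on_C2, C2x|split; [exact W|]].
      intros s _; generalize (conic s).
      simpl prof_x; set (w := sqrt (rad x s)); unfold rad; intros E; lra.
  + intros [c1 [c2 iso]].
    destruct (iso s1 (in_real_line s1)) as [E1 _].
    destruct (iso s2 (in_real_line s2)) as [E2 _].
    simpl in E1, E2; unfold k1 in E1, E2.
    (* Eliminating [x] by the conic makes [k1] a function of [u^2] alone, known at [s1] and [s2]. *)
    assert (k1E : forall s, sqrt (rad x s) / x s = 8 * rad x s / (7 - 6 * rad x s)).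
    { intros s.
      assert (upos := sqrt_lt_R0 _ (rpos s)).
      replace (7 - 6 * rad x s) with (8 * x s * sqrt (rad x s))
        by (generalize (conic s); lra).
      replace (8 * rad x s) with (8 * sqrt (rad x s) ^ 2)
        by (rewrite pow2_sqrt; [reflexivity|apply Rlt_le, rpos]).
      generalize (xpos s); intros; field; lra. }
    rewrite k1E, r1 in E1; rewrite k1E, r2 in E2; lra.
- intros S [HS Hiso]; split; [exact HS|split; [|exact Hiso]].
  destruct HS as [a [b [c [[_ W] _]]]].
  apply immersed_off_axis; intros s Is.
  destruct (W s Is) as [xs [rs _]]; split; assumption.
Qed.
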